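(* Let $\mathbf{x}_1,\dots,\mathbf{x}_N\in\mathbb{R}^K$ be nonzero, let $\mathbf{T}$ be a real symmetric positive definite $K\times K$ matrix, and let $\alpha_0>0$. If the equation $$\boldsymbol{\Sigma}=\frac{1}{1+\alpha_0}\frac KN\sum_{i=1}^N\frac{\mathbf{x}_i\mathbf{x}_i^T}{\mathbf{x}_i^T\boldsymbol{\Sigma}^{-1}\mathbf{x}_i}+\frac{\alpha_0}{1+\alpha_0}\mathbf{T}$$ admits a solution $\boldsymbol{\Sigma}\in\mathbb{S}_{++}^K$, then for every proper subspace $S\subseteq\mathbb{R}^K$, $$P_N(S)<\frac{(1+\alpha_0)\dim(S)}{K}.$$
   Context: $\mathbb{S}_{++}^K$ is the set of real symmetric positive definite $K\times K$ matrices. $P_N(S)=\frac1N\sum_{i=1}^N 1_{\{\mathbf{x}_i\in S\}}$ is the proportion of samples lying in $S$. ''Proper subspace'' means a linear subspace $S$ with $1\le\dim S\le K-1$. *)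

(* Defs.v *)
From mathcomp Require Export all_boot all_order all_algebra.
From mathcomp Require Export reals.

Set Implicit Arguments.
Unset Strict Implicit.
Unset Printing Implicit Defensive.

Import GRing.Theory Num.Theory.
Local Open Scope ring_scope.

Definition qform (R : realType) (K : nat) (A : 'M[R]_K) (x : 'cV[R]_K) : R :=
  (x^T *m A *m x) 0 0.

Definition symposdef (R : realType) (K : nat) (A : 'M[R]_K) : Prop :=
  A^T = A /\ forall x : 'cV[R]_K, x != 0 -> 0 < qform A x.

(* The empirical measure of the sample [x], on subspaces of R^K. *)
Definition sample_prop (R : realType) (K N : nat) (x : 'I_N -> 'cV[R]_K)
    (S : {vspace 'cV[R]_K}) : R :=
  N%:R^-1 * \sum_(i < N) (x i \in S)%:R.

(* For [Sigma] positive definite, [Sigma \in unitmx] and the denominators at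
   nonzero [x i] are positive, so [invmx] and [^-1] are genuine inverses. *)
Definition regTyler_map (R : realType) (K N : nat) (x : 'I_N -> 'cV[R]_K)
    (T : 'M[R]_K) (alpha0 : R) (Sigma : 'M[R]_K) : 'M[R]_K :=
  (1 / (1 + alpha0) * (K%:R / N%:R)) *:
    (\sum_(i < N) (qform (invmx Sigma) (x i))^-1 *: (x i *m (x i)^T))
  + (alpha0 / (1 + alpha0)) *: T.

(* Main.v *)
(* Write M = Sigma^-1 and choose a basis B of S with B^T M B = 1. Multiplying
   the equation by M on both sides and taking the trace of its compression by B
   gives dim S on the left; on the right each sample contributes
   |B^T M x_i|^2 / (x_i^T M x_i), which is nonnegative and equals 1 when
   x_i lies in S, while T contributes a strictly positive trace. *)
Require Import Defs.
From mathcomp Require Import all_boot all_order all_algebra.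
From mathcomp Require Import reals.

Set Implicit Arguments.
Unset Strict Implicit.
Unset Printing Implicit Defensive.

Import Order.TTheory GRing.Theory Num.Theory.
Local Open Scope ring_scope.

Lemma qformM (R : realType) (m n : nat) (A : 'M[R]_m) (B : 'M[R]_(m, n))
    (x : 'cV[R]_n) :
  qform (B^T *m A *m B) x = qform A (B *m x).
Proof. by rewrite /qform trmx_mul !mulmxA. Qed.

Lemma qform_delta (R : realType) (n : nat) (A : 'M[R]_n) (k : 'I_n) :
  qform A (delta_mx k 0) = A k k.
Proof. by rewrite /qform trmx_delta -rowE -colE !mxE. Qed.

Lemma symposdef_congr (R : realType) (m n : nat) (A : 'M[R]_m)
    (B : 'M[R]_(m, n)) :
  symposdef A -> (forall x : 'cV[R]_n, B *m x = 0 -> x = 0) ->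
  symposdef (B^T *m A *m B).
Proof.
move=> [symA posA] injB; split=> [|x x0].
  by rewrite !trmx_mul trmxK symA mulmxA.
by rewrite qformM posA //; apply: contra_neq x0; apply: injB.
Qed.

Lemma symposdef_unitmx (R : realType) (n : nat) (A : 'M[R]_n) :
  symposdef A -> A \in unitmx.
Proof.
move=> [_ posA]; rewrite -row_free_unit; apply: inj_row_free => v vA0.
apply/eqP/negPn/negP => v0.
have := posA v^T; rewrite /qform trmxK vA0 mul0mx mxE ltxx => /(_ _)/negP.
by rewrite trmx_eq0 v0 => /(_ isT); case.
Qed.

Lemma unitmx_inj (R : realType) (n p : nat) (A : 'M[R]_n) (x : 'M[R]_(n, p)) :
  A \in unitmx -> A *m x = 0 -> x = 0.
Proof. by move=> uA Ax0; rewrite -(mulKmx uA x) Ax0 mulmx0. Qed.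

(** By symmetry of [A], its inverse is the congruence of [A] by [invmx A], so positivity is
    inherited. *)
Lemma symposdef_inv (R : realType) (n : nat) (A : 'M[R]_n) :
  symposdef A -> symposdef (invmx A).
Proof.
move=> pdA; have uA := symposdef_unitmx pdA.
have -> : invmx A = (invmx A)^T *m A *m invmx A.
  by rewrite -mulmxA mulmxV // mulmx1 trmx_inv pdA.1.
by apply: symposdef_congr => // x; apply: unitmx_inj; rewrite unitmx_inv.
Qed.

(** Induction on the size, in the manner of Cholesky: the corner entry is positive, so a congruence
    normalizes it to 1 and splits it off, and the block left over is again positive definite. *)
Lemma symposdef_congr1 (R : realType) (n : nat) (G : 'M[R]_n) :
  symposdef G -> exists L : 'M[R]_n, L^T *m G *m L = 1%:M.
Proof.
elim: n G => [|n IHn] G pdG; first by exists 0; apply/matrixP => -[].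
rewrite -[n.+1]/(1 + n)%N in G pdG *.
pose a := G 0 0.
have a0 : 0 < a.
  rewrite /a -qform_delta; apply: pdG.2; apply/eqP => /colP/(_ 0)/eqP.
  by rewrite !mxE !eqxx oner_eq0.
have ulG : ulsubmx G = a%:M.
  by apply/matrixP => i j; rewrite !ord1 !mxE /= !(lshift0, mulr1n).
have dlG : dlsubmx G = (ursubmx G)^T by rewrite trmx_ursub pdG.1.
pose u := ursubmx G; pose s := (Num.sqrt a)^-1.
have s0 : s != 0 by rewrite invr_eq0 gt_eqF // sqrtr_gt0.
have ssa : s * s * a = 1.
  by rewrite -invfM -expr2 sqr_sqrtr ?ltW // mulVf ?gt_eqF.
(* Clears the first row and column of G, leaving the Schur complement of a. *)
pose H : 'M[R]_(1 + n) := block_mx s%:M (- a^-1 *: u) 0 1%:M.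
have uH : H \in unitmx.
  by rewrite unitmxE det_ublock det1 mulr1 det_scalar1 unitfE.
have pdH : symposdef (H^T *m G *m H).
  by apply: symposdef_congr => // x; apply: unitmx_inj.
pose D := drsubmx (H^T *m G *m H).
have HGH : H^T *m G *m H = block_mx 1%:M 0 0 D.
  (* Only the three other blocks have to be computed; the lower right one is left to unification. *)
  suff [E HE] : exists E, H^T *m G *m H = block_mx 1%:M 0 0 E.
    by rewrite /D HE block_mxKdr.
  rewrite -mulmxA -[G]submxK ulG dlG -/u /H tr_block_mx !mulmx_block.
  rewrite !(trmx0, trmx1, tr_scalar_mx, mul0mx, mulmx0, mulmx1, addr0, add0r).
  have -> : a%:M *m (- a^-1 *: u) + u = 0.
    by rewrite mul_scalar_mx scalerA mulrN mulfV ?gt_eqF // scaleN1r addNr.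
  have -> : (- a^-1 *: u)^T *m (a%:M *m s%:M) + 1%:M *m (u^T *m s%:M) = 0.
    rewrite mul1mx mulmxA -mulmxDl [(_ *: u)^T]linearZ /= [_ *m a%:M]mul_mx_scalar scalerA.
    by rewrite mulrN mulfV ?gt_eqF // scaleN1r addNr mul0mx.
  by rewrite -!scalar_mxM mulrCA [_ * (s * s)]mulrC ssa mulmx0; eexists.
have pdD : symposdef D.
  (* [D] is the restriction of the form to the last [n] coordinates, hence a congruence by an
     injective matrix. *)
  have -> : D = (col_mx 0 1%:M)^T *m (H^T *m G *m H) *m (col_mx 0 1%:M : 'M_(1 + n, n)).
    rewrite HGH tr_col_mx mul_row_block mul_row_col.
    by rewrite !(trmx0, trmx1, mul0mx, mulmx0, mul1mx, mulmx1, add0r).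
  apply: symposdef_congr => // x; rewrite mul_col_mx mul1mx mul0mx.
  by rewrite -[RHS]col_mx0 => /eq_col_mx[].
have [L LD] := IHn _ pdD.
exists (H *m block_mx 1%:M 0 0 L).
rewrite trmx_mul mulmxA -(mulmxA _ H^T G) -(mulmxA _ (H^T *m G) H) HGH tr_block_mx.
rewrite !mulmx_block !(trmx0, trmx1, mul0mx, mulmx0, mul1mx, mulmx1, add0r, addr0).
by rewrite LD -scalar_mx_block.
Qed.

(** The columns of [A] are a basis of [S]: freeness gives injectivity, and coordinates give the
    preimages. *)
Lemma vspace_mx (R : realType) (K : nat) (S : {vspace 'cV[R]_K}) :
  exists A : 'M[R]_(K, \dim S),
    (forall y : 'cV[R]_(\dim S), A *m y = 0 -> y = 0) /\
    (forall x : 'cV[R]_K, x \in S -> exists y : 'cV[R]_(\dim S), x = A *m y).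
Proof.
pose A : 'M[R]_(K, \dim S) := \matrix_(i, j) (vbasis S)`_j i 0.
have AE (y : 'cV[R]_(\dim S)) : A *m y = \sum_j y j 0 *: (vbasis S)`_j.
  apply/colP => i; rewrite mxE summxE; apply: eq_bigr => j _.
  by rewrite !mxE mulrC.
exists A; split=> [y|x xS].
  have /freeP freeX := basis_free (vbasisP S).
  by rewrite AE => /freeX y0; apply/colP => i; rewrite y0 mxE.
exists (\col_j coord (vbasis S) j x).
rewrite AE {1}(coord_vbasis xS).
by apply: eq_bigr => j _; rewrite mxE.
Qed.

(** The Gram matrix of a basis of [S] for the form [M] is positive definite, so some [L] reduces it
    to the identity. This [L] is invertible, hence the new columns still span [S]. *)
Lemma vspace_orthonormal (R : realType) (K : nat) (M : 'M[R]_K)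
    (S : {vspace 'cV[R]_K}) :
  symposdef M ->
  exists B : 'M[R]_(K, \dim S), B^T *m M *m B = 1%:M /\
    (forall x : 'cV[R]_K, x \in S -> exists y : 'cV[R]_(\dim S), x = B *m y).
Proof.
move=> pdM; have [A [injA spanA]] := vspace_mx S.
have [L LGL] := symposdef_congr1 (symposdef_congr pdM injA).
have [_ uL] := mulmx1_unit LGL.
exists (A *m L); split; first by rewrite trmx_mul -LGL !mulmxA.
move=> x /spanA[y ->]; exists (invmx L *m y).
by rewrite mulmxA mulmxK.
Qed.

Lemma mxtrace_qform (R : realType) (m n : nat) (A : 'M[R]_m)
    (C : 'M[R]_(m, n)) :
  \tr (C^T *m A *m C) = \sum_j qform A (col j C).
Proof.
by apply: eq_bigr => j _; rewrite colE -qformM qform_delta.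
Qed.

(** The trace sums the form over the columns of [C], which are nonzero by injectivity; [0 < n]
    provides at least one of them. *)
Lemma mxtrace_symposdef_gt0 (R : realType) (m n : nat) (A : 'M[R]_m)
    (C : 'M[R]_(m, n)) :
  (0 < n)%N -> symposdef A -> (forall y : 'cV[R]_n, C *m y = 0 -> y = 0) ->
  0 < \tr (C^T *m A *m C).
Proof.
case: n C => // n C _ pdA injC.
rewrite mxtrace_qform big_ord_recl.
have Cj_gt0 j : 0 < qform A (col j C).
  apply: pdA.2; apply/eqP; rewrite colE => /injC /colP /(_ j) /eqP.
  by rewrite !mxE !eqxx oner_eq0.
by rewrite ltr_pwDl // sumr_ge0 // => j _; rewrite ltW.
Qed.

Lemma mxtrace_outer (R : realType) (m n : nat) (C : 'M[R]_(m, n))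
    (x : 'cV[R]_m) :
  \tr (C^T *m (x *m x^T) *m C) = qform 1%:M (C^T *m x).
Proof.
rewrite /qform mulmx1 trmx_mul trmxK mulmxA -mulmxA mxtrace_mulC.
by rewrite /mxtrace big_ord1.
Qed.

Lemma qform1_ge0 (R : realType) (n : nat) (x : 'cV[R]_n) : 0 <= qform 1%:M x.
Proof.
rewrite /qform mulmx1 mxE sumr_ge0 // => i _.
by rewrite mxE -expr2 sqr_ge0.
Qed.

Theorem proposition13 (R : realType) (K N : nat) (x : 'I_N -> 'cV[R]_K)
    (T : 'M[R]_K) (alpha0 : R)
    (N_gt0 : (0 < N)%N)
    (x_neq0 : forall i : 'I_N, x i != 0)
    (T_pd : symposdef T)
    (alpha0_gt0 : 0 < alpha0)
    (sol : exists Sigma : 'M[R]_K,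
       symposdef Sigma /\ Sigma = regTyler_map x T alpha0 Sigma) :
  forall S : {vspace 'cV[R]_K}, (1 <= \dim S <= K - 1)%N ->
    sample_prop x S < (1 + alpha0) * (\dim S)%:R / K%:R.
Proof.
move=> S /andP[dimS_gt0 dimS_lt].
have K_gt0 : (0 < K)%N.
  by have := leq_trans dimS_gt0 dimS_lt; rewrite subn_gt0; apply: ltnW.
have [Sigma [pdS eqS]] := sol.
have uS := symposdef_unitmx pdS.
set M := invmx Sigma.
have pdM : symposdef M := symposdef_inv pdS.
have [B [BMB spanB]] := vspace_orthonormal S pdM.
(* Conjugation by [C] performs both the multiplication by [M] on each side and the compression by
   [B]; it sends [Sigma] to [B^T M B = 1]. *)
pose C := M *m B.
have CT : C^T = B^T *m M by rewrite trmx_mul pdM.1.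
have injC (y : 'cV[R]_(\dim S)) : C *m y = 0 -> y = 0.
  by move=> Cy0; rewrite -[y]mul1mx -BMB -!mulmxA [M *m _]mulmxA Cy0 mulmx0.
have trS : \tr (C^T *m Sigma *m C) = (\dim S)%:R.
  by rewrite CT mulmxKV // /C mulmxA BMB mxtrace1.
have trT := mxtrace_symposdef_gt0 dimS_gt0 T_pd injC.
have alpha1_gt0 : 0 < 1 + alpha0 by rewrite addr_gt0.
(* If [x i = B y], then [C^T x i = y] and the form [M] at [x i] is the squared norm of [y], so the
   ratio is 1. Outside [S] nonnegativity suffices. *)
have sumC : \sum_(i < N) (x i \in S)%:R <=
    \sum_(i < N) (qform M (x i))^-1 * qform 1%:M (C^T *m x i).
  apply: ler_sum => i _; have q_gt0 := pdM.2 _ (x_neq0 i).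
  case: (boolP (x i \in S)) => [/spanB[y xE]|_]; last first.
    by rewrite mulr_ge0 ?qform1_ge0 // invr_ge0 ltW.
  rewrite xE CT mulmxA BMB mul1mx -{1}BMB qformM mulVf //.
  by rewrite -xE gt_eqF.
move: trS; rewrite {1}eqS /regTyler_map mulmxDr mulmxDl mxtraceD.
rewrite -!scalemxAr -!scalemxAl !mxtraceZ mulmx_sumr mulmx_suml raddf_sum /=.
under eq_bigr do rewrite -scalemxAr -scalemxAl mxtraceZ mxtrace_outer.
rewrite -/M => trE.
rewrite ltr_pdivlMr ?ltr0n // -ltr_pdivrMl // -trE /sample_prop.
(* The middle term is the sample part of the trace: [sumC] bounds it from below, and the trace
   coming from [T] makes the upper inequality strict. *)
apply: (@le_lt_trans _ _ (1 / (1 + alpha0) * (K%:R / N%:R) *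
    \sum_(i < N) (qform M (x i))^-1 * qform 1%:M (C^T *m x i))); last first.
  by rewrite ltrDl mulr_gt0 ?divr_gt0.
rewrite mul1r -!mulrA ler_pM2l ?invr_gt0 // [_ * K%:R]mulrC mulrCA.
by rewrite ler_pM2l ?ltr0n // ler_pM2l ?invr_gt0 ?ltr0n.
Qed.
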